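(* Let $(d_n)_{n\ge1}$ be a fixed sequence of integers $d_n\ge2$, let $k\ge1$ and $c\in\{0,1,\dots,d_k-1\}$. The diameter of the set $\Delta^k_c$ is $$d(\Delta^k_c)=\frac{d_1d_2\cdots d_k-d_k+1}{d_1d_2\cdots d_k}.$$
   Context: Put $a_0=\sum_{n=1}^{\infty}\frac{(-1)^{n+1}}{d_1d_2\cdots d_n}$. For digits $\varepsilon_n\in\{0,\dots,d_n-1\}$ put $\Delta^{-D}_{\varepsilon_1\varepsilon_2\ldots}=\sum_{n=1}^{\infty}\frac{(-1)^n\varepsilon_n}{d_1d_2\cdots d_n}$; every number of $[a_0-1;a_0]$ has such a representation. The set $\Delta^k_c$ is the set of all numbers of $[a_0-1;a_0]$ having a representation $\Delta^{-D}_{\varepsilon_1\varepsilon_2\ldots}$ with $\varepsilon_k=c$. *)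

(* Defs.v *)
From HB Require Import structures.
From mathcomp Require Import all_boot all_order all_algebra.
From mathcomp Require Import all_classical all_reals all_analysis.
Set Implicit Arguments.
Unset Strict Implicit.
Unset Printing Implicit Defensive.
Import Order.TTheory GRing.Theory Num.Theory.
Import numFieldNormedType.Exports.
Local Open Scope classical_set_scope.
Local Open Scope ring_scope.

(* Sequences of bases and digits are indexed from 1: the values [d 0] and
   [e 0] are never used. *)
Definition is_base (d : nat -> nat) : Prop :=
  forall n, (1 <= n)%N -> (2 <= d n)%N.

Definition is_digits (d e : nat -> nat) : Prop :=
  forall n, (1 <= n)%N -> (e n < d n)%N.

Definition base_prod (d : nat -> nat) (n : nat) : nat :=
  (\prod_(1 <= i < n.+1) d i)%N.

(* The two series below converge in [R] for every base [d] and every digit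
   sequence [e]: see [is_cvg_Delta] and [is_cvg_a0]. *)
Definition a0 (R : realType) (d : nat -> nat) : R :=
  \big[+%R/0]_(1 <= n <oo) ((-1) ^+ n.+1 / (base_prod d n)%:R : R).

Definition Delta (R : realType) (d e : nat -> nat) : R :=
  \big[+%R/0]_(1 <= n <oo) ((-1) ^+ n * (e n)%:R / (base_prod d n)%:R : R).

Definition Delta_set (R : realType) (d : nat -> nat) (k c : nat) : set R :=
  [set x | a0 R d - 1 <= x <= a0 R d /\
           exists e, [/\ is_digits d e, e k = c & x = Delta R d e]].
Arguments Delta_set : clear implicits.

(* Valued in the extended reals, so that a finite diameter also means that
   the set is bounded. *)
Definition diameter (R : realType) (A : set R) : \bar R :=
  ereal_sup [set `|xy.1 - xy.2|%:E | xy in A `*` A].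

Lemma base_prod_gt0 (d : nat -> nat) (n : nat) :
  is_base d -> (0 < base_prod d n)%N.
Proof.
move=> hd; rewrite /base_prod big_nat; apply: prodn_cond_gt0 => i /andP[i1 _].
exact: ltnW (hd _ i1).
Qed.

Lemma sum_digits_le (R : realType) (d e : nat -> nat) (N : nat) :
  is_base d -> is_digits d e ->
  \sum_(0 <= n < N) ((e n.+1)%:R / (base_prod d n.+1)%:R : R)
    <= 1 - (base_prod d N)%:R^-1.
Proof.
move=> hd he; elim: N => [|N IH].
  by rewrite big_geq// /base_prod big_geq// invr1 subrr.
rewrite big_nat_recr//=; apply: (le_trans (lerD IH (lexx _))).
have P0 : (0 : R) < (base_prod d N)%:R by rewrite ltr0n base_prod_gt0.
have PS : base_prod d N.+1 = (base_prod d N * d N.+1)%N.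
  by rewrite /base_prod big_nat_recr.
have D0 : (0 : R) < (d N.+1)%:R by rewrite ltr0n; exact: ltnW (hd _ _).
have eD : (e N.+1)%:R <= (d N.+1)%:R - 1 :> R.
  by rewrite lerBrDr natr1 ler_nat; exact: he.
rewrite PS natrM -addrA lerD2l addrC lerBlDr addrC.
rewrite -(ler_pM2r (mulr_gt0 P0 D0)) mulrDl mulNr.
rewrite mulVf ?mulf_neq0 ?gt_eqF// mulfVK ?mulf_neq0 ?gt_eqF//.
by rewrite mulKf ?gt_eqF// addrC.
Qed.

Lemma is_cvg_Delta (R : realType) (d e : nat -> nat) :
  is_base d -> is_digits d e ->
  cvgn (fun N => \sum_(1 <= n < N)
    ((-1) ^+ n * (e n)%:R / (base_prod d n)%:R : R)).
Proof.
move=> hd he.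
set u := fun n => ((-1) ^+ n.+1 * (e n.+1)%:R / (base_prod d n.+1)%:R : R).
have cu : cvgn (series u).
  apply: normed_cvg; apply: nondecreasing_is_cvgn.
    by apply: nondecreasing_series => n _ _; exact: normr_ge0.
  exists 1 => _ [N _ <-]; apply: (@le_trans _ _ (1 - (base_prod d N)%:R^-1)).
    apply: le_trans (sum_digits_le _ _ hd he); rewrite le_eqVlt; apply/orP; left.
    apply/eqP; apply: eq_bigr => n _.
    by rewrite /u /= !normrM normrX normrN1 expr1n mul1r normfV !normr_nat.
  by rewrite gerBl invr_ge0 ler0n.
apply/cvg_ex; case/cvg_ex : cu => l ul; exists l.
rewrite -cvg_shiftS; apply: cvg_trans ul; apply: near_eq_cvg.
by near=> N; rewrite /series/= big_add1.
Unshelve. all: by end_near. Qed.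

Lemma is_cvg_a0 (R : realType) (d : nat -> nat) :
  is_base d ->
  cvgn (fun N => \sum_(1 <= n < N) ((-1) ^+ n.+1 / (base_prod d n)%:R : R)).
Proof.
move=> hd.
have h1 : is_digits d (fun=> 1%N) by move=> n /hd.
have /cvg_ex[l fl] := @is_cvg_Delta R d _ hd h1.
apply/cvg_ex; exists (- l); apply: cvg_trans (cvgN fl); apply: near_eq_cvg.
near=> N; rewrite /= fctE -sumrN; apply: eq_bigr => n _.
by rewrite exprS mulr1 mulN1r mulNr.
Unshelve. all: by end_near. Qed.

(* Main.v *)
Require Import Defs.
From HB Require Import structures.
From mathcomp Require Import all_boot all_order all_algebra.
From mathcomp Require Import all_classical all_reals all_analysis.
From mathcomp Require Import ring lra.
Local Open Scope ring_scope.

(** Two digit sequences [e] and [f] that agree at [k] satisfy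
    [Delta e - Delta f = \sum_(n != k) (-1)^n (e n - f n) / (d 1 ... d n)],
    where [e n - f n] has absolute value at most [d n - 1].  The weights
    [(d n - 1) / (d 1 ... d n) = 1 / (d 1 ... d n.-1) - 1 / (d 1 ... d n)]
    telescope to a total of [1], so the difference is at most
    [1 - (d k - 1) / (d 1 ... d k)], which is the diameter
    ([Delta_dist_le]).  Equality holds when, away from [k], the digits [e n] are
    as large as possible at even places and zero at odd places, and the digits
    [f n] the other way round ([Delta_extremal]).

    It remains to see that the constraint [a0 - 1 <= x <= a0] in the definition
    of the set excludes no digit sequence.  This holds because
    [Delta e - a0 = \sum_n (-1)^n (e n + 1) / (d 1 ... d n)] with
    [1 <= e n + 1 <= d n]: each partial sum lies in [[-1, 0]]
    ([Delta_a0_partial_bounds]). *)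

Import Order.TTheory GRing.Theory Num.Theory.
Import numFieldNormedType.Exports.
Local Open Scope classical_set_scope.

Lemma base_prodS (d : nat -> nat) n :
  base_prod d n.+1 = (base_prod d n * d n.+1)%N.
Proof. by rewrite /base_prod big_nat_recr. Qed.

Lemma base_prod_ge_exp2 (d : nat -> nat) n :
  is_base d -> (2 ^ n <= base_prod d n)%N.
Proof.
move=> hd; elim: n => [|n IH]; first exact: base_prod_gt0.
by rewrite base_prodS expnSr leq_mul ?hd.
Qed.

Lemma inv_base_prod_cvg0 (R : realType) (d : nat -> nat) :
  is_base d -> (fun n => (base_prod d n)%:R^-1 : R) @ \oo --> (0 : R).
Proof.
move=> hd.
have h2 : (fun n => (1 / 2 : R) ^+ n) @ \oo --> (0 : R).
  by apply: cvg_expr; rewrite ger0_norm; lra.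
apply: (squeeze_cvgr _ (cvg_cst 0) h2).
near=> n; rewrite invr_ge0 ler0n /= expr_div_n expr1n div1r -natrX.
by rewrite lef_pV2 ?posrE ?ltr0n ?expn_gt0 ?base_prod_gt0// ler_nat
  base_prod_ge_exp2.
Unshelve. all: by end_near. Qed.

(** The largest possible contribution to a difference of two expansions of the
    digits at place [n]. *)
Definition place_weight (R : realType) (d : nat -> nat) (n : nat) : R :=
  ((d n)%:R - 1) / (base_prod d n)%:R.

Lemma base_prodR_gt0 (R : realType) (d : nat -> nat) n :
  is_base d -> 0 < (base_prod d n)%:R :> R.
Proof. by move=> hd; rewrite ltr0n base_prod_gt0. Qed.

Lemma base_div_prodS (R : realType) (d : nat -> nat) n : is_base d ->
  (d n.+1)%:R / (base_prod d n.+1)%:R = (base_prod d n)%:R^-1 :> R.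
Proof.
move=> hd; have d0 : (d n.+1)%:R != 0 :> R.
  by rewrite pnatr_eq0 -lt0n ltnW ?hd.
by rewrite base_prodS natrM invfM mulrCA mulfV ?mulr1.
Qed.

Lemma sum_place_weight (R : realType) (d : nat -> nat) N : is_base d ->
  \sum_(1 <= n < N.+1) place_weight R d n = 1 - (base_prod d N)%:R^-1.
Proof.
move=> hd; elim: N => [|N IH].
  by rewrite /base_prod !big_geq// invr1 subrr.
rewrite big_nat_recr//= IH /place_weight mulrBl base_div_prodS// div1r.
by rewrite addrA subrK.
Qed.

Lemma sum_place_weight_except (R : realType) (d : nat -> nat) k N :
  is_base d -> (1 <= k <= N)%N ->
  \sum_(1 <= n < N.+1 | n != k) place_weight R d n =
  1 - place_weight R d k - (base_prod d N)%:R^-1.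
Proof.
move=> hd kN; have := sum_place_weight R d N hd.
rewrite (bigD1_seq k) ?iota_uniq ?mem_index_iota ?ltnS//=.
by move=> h; rewrite addrAC -h addrAC subrr add0r.
Qed.

Lemma Delta_sub_cvg (R : realType) (d e f : nat -> nat) :
  is_base d -> is_digits d e -> is_digits d f ->
  (fun N => \sum_(1 <= n < N.+1)
     ((-1) ^+ n * ((e n)%:R - (f n)%:R) / (base_prod d n)%:R : R)) @ \oo
  --> Delta R d e - Delta R d f.
Proof.
move=> hd he hf.
rewrite (cvg_shiftS (fun N => \sum_(1 <= n < N) _)).
apply: cvg_trans (cvgB (@is_cvg_Delta R d e hd he) (@is_cvg_Delta R d f hd hf)).
apply: near_eq_cvg; near=> N.
rewrite /= fctE -sumrB; apply: eq_bigr => n _.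
by rewrite mulrBr mulrBl.
Unshelve. all: by end_near. Qed.

Lemma Delta_a0_sub_cvg (R : realType) (d e : nat -> nat) :
  is_base d -> is_digits d e ->
  (fun N => \sum_(1 <= n < N.+1)
     ((-1) ^+ n * ((e n)%:R + 1) / (base_prod d n)%:R : R)) @ \oo
  --> Delta R d e - a0 R d.
Proof.
move=> hd he.
rewrite (cvg_shiftS (fun N => \sum_(1 <= n < N) _)).
apply: cvg_trans (cvgB (@is_cvg_Delta R d e hd he) (@is_cvg_a0 R d hd)).
apply: near_eq_cvg; near=> N.
rewrite /= fctE -sumrB; apply: eq_bigr => n _.
by rewrite mulrDr mulrDl mulr1 exprS mulN1r mulNr opprK.
Unshelve. all: by end_near. Qed.

(** A term at an even place lies between the inverses of two consecutive
    products, a term at an odd place between their opposites.  The bounds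
    therefore leave a slack that depends on the parity of [N] and that the
    next term uses up. *)
Lemma Delta_a0_partial_bounds (R : realType) (d e : nat -> nat) N :
  is_base d -> is_digits d e ->
  - 1 + (~~ odd N)%:R / (base_prod d N)%:R
  <= \sum_(1 <= n < N.+1)
       ((-1) ^+ n * ((e n)%:R + 1) / (base_prod d n)%:R : R)
  <= - ((odd N)%:R / (base_prod d N)%:R).
Proof.
move=> hd he; elim: N => [|N].
  by rewrite /base_prod !big_geq//= divr1 mul0r; apply/andP; split; lra.
rewrite [in X in _ -> X]big_nat_recr//=.
set S := \sum_(1 <= n < N.+1) _.
have lo : (base_prod d N.+1)%:R^-1
    <= ((e N.+1)%:R + 1) / (base_prod d N.+1)%:R :> R.
  by rewrite -[leLHS]mul1r ler_wpM2r ?invr_ge0 ?ler0n// lerDr ler0n.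
have hi : ((e N.+1)%:R + 1) / (base_prod d N.+1)%:R
    <= (base_prod d N)%:R^-1 :> R.
  rewrite -(base_div_prodS R d N hd) ler_wpM2r ?invr_ge0 ?ler0n//.
  by rewrite natr1 ler_nat; exact: he.
rewrite -signr_odd -mulrA /=.
move: lo hi; set t := _ / _; case: (odd N) => /= lo hi /andP[h1 h2];
  rewrite ?expr0 ?expr1 ?mulN1r ?mul1r ?mul0r in h1 h2 *;
  by apply/andP; split; lra.
Qed.

Lemma Delta_bounds (R : realType) (d e : nat -> nat) :
  is_base d -> is_digits d e -> a0 R d - 1 <= Delta R d e <= a0 R d.
Proof.
move=> hd he; have cv := Delta_a0_sub_cvg R d e hd he.
have V0 (b : bool) N : 0 <= b%:R / (base_prod d N)%:R :> R.
  by rewrite divr_ge0 ?ler0n.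
suff /andP[h1 h2] : - 1 <= Delta R d e - a0 R d <= 0.
  by apply/andP; split; lra.
apply/andP; split.
- apply: (cvgr_to_ge cv); near=> N.
  have /andP[h _] := Delta_a0_partial_bounds R d e N hd he.
  by apply: le_trans h; rewrite lerDl V0.
- apply: (cvgr_to_le cv); near=> N.
  have /andP[_ h] := Delta_a0_partial_bounds R d e N hd he.
  by apply: (le_trans h); rewrite oppr_le0 V0.
Unshelve. all: by end_near. Qed.

Lemma Delta_dist_le (R : realType) (d e f : nat -> nat) k :
  is_base d -> is_digits d e -> is_digits d f -> (1 <= k)%N -> e k = f k ->
  `|Delta R d e - Delta R d f| <= 1 - place_weight R d k.
Proof.
move=> hd he hf k1 ek.
apply: (cvgr_to_le (cvg_norm (Delta_sub_cvg R d e f hd he hf))); near=> N.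
have kN : (k <= N)%N by near: N; exact: nbhs_infty_ge.
apply: (@le_trans _ _ (\sum_(1 <= n < N.+1 | n != k) place_weight R d n)).
  rewrite /= [X in `|X|](bigID (fun n => n != k)) /= addrC big1 ?add0r; last first.
    by move=> n /negPn/eqP ->; rewrite ek subrr mulr0 mul0r.
  apply: (le_trans (ler_norm_sum _ _ _)).
  rewrite [leLHS]big_nat_cond [leRHS]big_nat_cond.
  apply: ler_sum => n /andP[/andP[n1 _] _].
  rewrite !normrM normrX normrN1 expr1n mul1r normfV normr_nat.
  rewrite /place_weight ler_wpM2r ?invr_ge0 ?ler0n//.
  have := he _ n1; have := hf _ n1; rewrite -!(ler_nat R) -!natr1.
  have := ler0n R (e n); have := ler0n R (f n).
  by rewrite ler_norml => *; apply/andP; split; lra.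
by rewrite sum_place_weight_except ?k1// gerBl invr_ge0 ler0n.
Unshelve. all: by end_near. Qed.

(** The digits equal to [c] at place [k], maximal at the other places of parity
    [b], and zero elsewhere. *)
Definition extremal_digits (d : nat -> nat) (k c : nat) (b : bool) (n : nat) :=
  if n == k then c else if odd n == b then (d n).-1 else 0%N.

Lemma extremal_digitsP (d : nat -> nat) (k c : nat) (b : bool) :
  is_base d -> (c < d k)%N -> is_digits d (extremal_digits d k c b).
Proof.
move=> hd hc n n1; rewrite /extremal_digits.
have dn := ltnW (hd n n1).
by case: eqP => [->//|_]; case: ifP => // _; rewrite prednK.
Qed.

Lemma Delta_extremal (R : realType) (d : nat -> nat) (k c : nat) :
  is_base d -> (1 <= k)%N -> (c < d k)%N ->
  Delta R d (extremal_digits d k c false)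
    - Delta R d (extremal_digits d k c true) = 1 - place_weight R d k.
Proof.
move=> hd k1 hc.
have cv := Delta_sub_cvg R d _ _ hd (extremal_digitsP d k c false hd hc)
  (extremal_digitsP d k c true hd hc).
apply: (cvg_unique _ cv) => //=.
have : (fun N => 1 - place_weight R d k - (base_prod d N)%:R^-1 : R) @ \oo
    --> 1 - place_weight R d k - 0.
  by apply: cvgB; [exact: cvg_cst | exact: inv_base_prod_cvg0].
rewrite subr0 => h; apply: cvg_trans h; apply: near_eq_cvg; near=> N.
have kN : (k <= N)%N by near: N; exact: nbhs_infty_ge.
rewrite -sum_place_weight_except ?k1// big_mkcond /=.
rewrite big_nat_cond [RHS]big_nat_cond; apply: eq_bigr => n /andP[/andP[n1 _] _].
rewrite /extremal_digits; case: eqP => _ /=; first by rewrite subrr mulr0 mul0r.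
have dE : (d n).-1%:R = (d n)%:R - 1 :> R.
  by rewrite -[in RHS](prednK (ltnW (hd n n1))) -natr1 addrK.
rewrite /place_weight -dE -signr_odd.
by case: (odd n) => /=; rewrite ?expr0 ?expr1 ?subr0 ?sub0r ?mul1r ?mulN1r ?opprK.
Unshelve. all: by end_near. Qed.

Theorem lemma18 (R : realType) (d : nat -> nat) (hd : is_base d)
    (k c : nat) (hk : (1 <= k)%N) (hc : (c < d k)%N) :
  diameter (Delta_set R d k c) =
  (((base_prod d k)%:R - (d k)%:R + 1) / (base_prod d k)%:R)%:E.
Proof.
have -> : ((base_prod d k)%:R - (d k)%:R + 1) / (base_prod d k)%:R
    = 1 - place_weight R d k :> R.
  have P0 := base_prodR_gt0 R d k hd.
  by rewrite /place_weight; field; rewrite gt_eqF.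
apply/eqP; rewrite eq_le; apply/andP; split.
  apply: ge_ereal_sup => _ [[x y] [/=] [_ [e [he ek ->]]] [_ [f [hf fk ->]]] <-].
  by rewrite lee_fin; apply: Delta_dist_le => //; rewrite ek fk.
have mem b : Delta_set R d k c (Delta R d (extremal_digits d k c b)).
  have hb := extremal_digitsP d k c b hd hc.
  split; first exact: Delta_bounds.
  by exists (extremal_digits d k c b); split => //; rewrite /extremal_digits eqxx.
apply: ereal_sup_ubound.
exists (Delta R d (extremal_digits d k c false),
        Delta R d (extremal_digits d k c true)) => //=.
rewrite Delta_extremal// ger0_norm//.
have hb := extremal_digitsP d k c true hd hc.
exact: le_trans (normr_ge0 _) (Delta_dist_le R d _ _ k hd hb hb hk erefl).
Qed.
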